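(* Let $n \ge 3$, let $d_1, \ldots, d_n$ be integers with $d_i \ge 2$ for all $i$, let $k$ be a field of characteristic $p>0$, and let $A=k[x_1, \ldots, x_n]/(x_1^{d_1}, \ldots, x_n^{d_n})$. Let $t = \sum_{i = 1}^n (d_i-1)$ and assume $d_1=\max(d_1, \dots, d_n)$. Write $d_1=N_1p+r_1$ with $N_1$ an integer and $0<r_1\le p$. Then $A$ has the strong Lefschetz property if and only if one of the following two conditions holds: (1) $t <p$; (2) $d_1 > p$, $d_i \leq p$ for $i =2, \ldots, n$, and $\sum_{i=2}^n(d_i-1) \le \min(r_1,p-r_1)$.
   Context: $A$ is graded by degree, $A=\bigoplus_{i\ge 0}A_i$, with $A_i$ the image of the homogeneous polynomials of degree $i$. A linear map is said to have maximal rank if it is injective or surjective. A graded artinian algebra $A$ has the strong Lefschetz property (SLP) if there is a linear form $\ell\in A_1$ such that for all $i\ge 0$ and all $m\ge 1$ the map $A_i\to A_{i+m}$, $a\mapsto \ell^m a$, has maximal rank. *)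

(* Defs.v *)
From mathcomp Require Import all_boot all_algebra.
From mathcomp Require Import mpoly.
Set Implicit Arguments. Unset Strict Implicit. Unset Printing Implicit Defensive.
Import GRing.Theory.
Local Open Scope ring_scope.

Definition in_pow_ideal (k : comRingType) (n : nat) (d : nat -> nat)
    (f : {mpoly k[n]}) : Prop :=
  exists q : 'I_n -> {mpoly k[n]}, f = \sum_(j < n) q j * 'X_j ^+ d j.

(* A = k[x]/I, graded; A_i is the image of homogeneous polynomials of degree i.
   The map A_i -> A_(i+m), a |-> l^m a, has maximal rank (injective or surjective). *)
Definition mult_max_rank (k : comRingType) (n : nat) (d : nat -> nat)
    (l : {mpoly k[n]}) (i m : nat) : Prop :=
  (forall f : {mpoly k[n]}, f \is i.-homog ->
      in_pow_ideal d (l ^+ m * f) -> in_pow_ideal d f)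
  \/
  (forall g : {mpoly k[n]}, g \is (i + m)%N.-homog ->
      exists2 f : {mpoly k[n]}, f \is i.-homog & in_pow_ideal d (g - l ^+ m * f)).

Definition has_SLP (k : comRingType) (n : nat) (d : nat -> nat) : Prop :=
  exists2 l : {mpoly k[n]}, l \is 1.-homog &
    forall i m : nat, (0 < m)%N -> mult_max_rank d l i m.

(* Main.v *)
Require Import Defs.
From mathcomp Require Import all_boot all_algebra zify ring.
From mathcomp Require Import mpoly.

Set Implicit Arguments.
Unset Strict Implicit.
Unset Printing Implicit Defensive.
Import GRing.Theory.
Local Open Scope ring_scope.

(** Write [q = p ^ s]. Since [l ^ q] is a combination of the [x_i ^ q],
    multiplication by [l ^ (q * m)] preserves residues modulo [q] of exponents.
    If one residue class has no room left for a further factor [x_i ^ q] while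
    a monomial of the target degree lies in a class that the source degree does
    not reach, then the map is neither injective nor surjective; suitable
    choices of the classes exclude everything but (1) and (2).

    Conversely take [l] to be the sum of the variables. By duality it suffices
    that [l ^ (t - 2 * i)] is injective on [A_i] for [2 * i <= t]. If [t < p]
    this is the sl2 argument. In case (2) let [E] be the sum of the [d_i - 1]
    for [i >= 2]. If [i < E], then [l ^ (N_1 * p)] acts as [x_1 ^ (N_1 * p)],
    which reduces [d_1] to [r_1] and the claim to the first case; if [i >= E],
    the relation [x_1 ^ d_1] plays no role and [l ^ p] acts as the
    nonzerodivisor [x_1 ^ p]. *)

(** * Membership in the ideal of variable powers *)

Lemma mcoeffM_neq0 (R : comNzRingType) (n : nat) (f g : {mpoly R[n]})
    (c : 'X_{1..n}) : (f * g)@_c != 0 ->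
  exists a b, [/\ c = (a + b)%MM, f@_a != 0 & g@_b != 0].
Proof.
rewrite mcoeffM => fg0.
have /existsP[[a b] /= /andP[/eqP cab ab0]] :
  [exists k : 'X_{1..n < (mdeg c).+1, (mdeg c).+1},
    (c == k.1 + k.2)%MM && (f@_k.1 * g@_k.2 != 0)].
  apply: contraR fg0 => /existsPn fg0; apply/eqP/big1 => k ck.
  by have := fg0 k; rewrite ck negbK => /eqP.
exists a, b; split=> //.
  by apply: contraNneq ab0 => ->; rewrite mul0r.
by apply: contraNneq ab0 => ->; rewrite mulr0.
Qed.

Section PowerIdeal.
Variables (k : comNzRingType) (n : nat).
Implicit Types (d : nat -> nat) (f g : {mpoly k[n]}) (c : 'X_{1..n}).

Lemma in_pow_ideal0 d : in_pow_ideal d (0 : {mpoly k[n]}).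
Proof. by exists (fun _ => 0); rewrite big1 // => j _; rewrite mul0r. Qed.

Lemma in_pow_idealD d f g :
  in_pow_ideal d f -> in_pow_ideal d g -> in_pow_ideal d (f + g).
Proof.
move=> [q ->] [r ->]; exists (fun j => q j + r j).
by rewrite -big_split /=; apply: eq_bigr => j _; rewrite mulrDl.
Qed.

Lemma in_pow_idealMl d f g : in_pow_ideal d g -> in_pow_ideal d (f * g).
Proof.
move=> [q ->]; exists (fun j => f * q j).
by rewrite mulr_sumr; apply: eq_bigr => j _; rewrite mulrA.
Qed.

Lemma in_pow_idealMr d f g : in_pow_ideal d f -> in_pow_ideal d (f * g).
Proof. by move=> fI; rewrite mulrC; apply: in_pow_idealMl. Qed.

Lemma in_pow_idealN d f : in_pow_ideal d f -> in_pow_ideal d (- f).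
Proof. by rewrite -mulN1r; apply: in_pow_idealMl. Qed.

Lemma in_pow_idealB d f g :
  in_pow_ideal d f -> in_pow_ideal d g -> in_pow_ideal d (f - g).
Proof. by move=> fI gI; apply/in_pow_idealD/in_pow_idealN. Qed.

Lemma in_pow_ideal_sum d (I : Type) (r : seq I) (P : pred I)
    (F : I -> {mpoly k[n]}) :
  (forall i, P i -> in_pow_ideal d (F i)) ->
  in_pow_ideal d (\sum_(i <- r | P i) F i).
Proof.
move=> FI.
by elim/big_ind: _ => //; [exact: in_pow_ideal0|exact: in_pow_idealD].
Qed.

Lemma in_pow_idealXn d (j : 'I_n) e :
  (d j <= e)%N -> in_pow_ideal d ('X_j ^+ e : {mpoly k[n]}).
Proof.
move=> de; rewrite -(subnK de) exprD; apply: in_pow_idealMl.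
exists (fun i => (i == j)%:R); rewrite (bigD1 j) //= eqxx mul1r big1 ?addr0 //.
by move=> i /negbTE ->; rewrite mul0r.
Qed.

Lemma in_pow_idealX d c (j : 'I_n) :
  (d j <= c j)%N -> in_pow_ideal d ('X_[c] : {mpoly k[n]}).
Proof.
move=> dc; rewrite mpolyXE_id (bigD1 j) //=.
exact/in_pow_idealMr/in_pow_idealXn.
Qed.

(** The ideal is generated by monomials, so membership can be tested on each coefficient
    separately. *)
Lemma in_pow_idealP d f :
  in_pow_ideal d f <-> (forall c, (forall i : 'I_n, c i < d i)%N -> f@_c = 0).
Proof.
split=> [[q ->] c cd|f0].
  rewrite raddf_sum /= big1 // => j _; apply/eqP; apply: contraT.
  case/mcoeffM_neq0 => a [b [cab _]].
  rewrite mcoeffXn; have [bE _|_ /eqP//] := eqVneq (U_(j) *+ d j)%MM b.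
  by have := cd j; rewrite cab -bE mnmDE mulmnE mnm1E eqxx mul1n; lia.
rewrite (mpolyE f) big_seq; apply: in_pow_ideal_sum => c cf.
have [/forallP /= cd|/forallPn[j]] := boolP [forall i : 'I_n, (c i < d i)%N].
  by rewrite f0 // scale0r; apply: in_pow_ideal0.
by rewrite -leqNgt -mul_mpolyC => dc; apply/in_pow_idealMl/(in_pow_idealX dc).
Qed.

End PowerIdeal.

(** * Frobenius powers of linear forms and failure of maximal rank *)

Section Frobenius.
Variables (k : fieldType) (p n : nat).
Hypothesis charkp : p \in [pchar k].

Lemma mpoly_exp_sum_pchar s (I : Type) (r : seq I) (F : I -> {mpoly k[n]}) :
  (\sum_(i <- r) F i) ^+ (p ^ s) = \sum_(i <- r) F i ^+ (p ^ s).
Proof.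
have pr_p := pcharf_prime charkp.
apply: (big_morph (fun f : {mpoly k[n]} => f ^+ (p ^ s))) => [f g|].
  apply: exprDn_pchar; rewrite pnatX; apply/orP; left.
  apply/pnatP=> [|q pr_q]; rewrite ?prime_gt0 // dvdn_prime2 // => /eqP ->.
  by rewrite pchar_lalg.
by rewrite expr0n expn_eq0 -leqn0 leqNgt prime_gt0.
Qed.

Lemma linear_formE (l : {mpoly k[n]}) : l \is 1.-homog ->
  l = \sum_(j < n) l@_U_(j) *: 'X_j.
Proof.
move=> l1; apply/mpolyP => c; rewrite raddf_sum /=.
under eq_bigr do rewrite mcoeffZ mcoeffX.
have [/mdeg1P[i /eqP ->]|c1] := boolP (mdeg c == 1%N).
  rewrite (bigD1 i) //= eqxx mulr1 big1 ?addr0 // => j /negbTE ji.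
  by rewrite eq_mnm1 ji mulr0.
rewrite (dhomog_nemf_coeff l1) // big1 // => j _.
by case: eqP => [jc|_]; rewrite ?mulr0 //; move: c1; rewrite -jc mdeg1.
Qed.

Lemma linear_form_exp_supp (l : {mpoly k[n]}) s m c : l \is 1.-homog ->
  (l ^+ (p ^ s * m))@_c != 0 -> forall i, (p ^ s %| c i)%N.
Proof.
move=> l1; rewrite exprM {1}(linear_formE l1) mpoly_exp_sum_pchar.
elim: m c => [c|m IHm c].
  rewrite mcoeff1; have [-> _ i|_ /eqP//] := eqVneq c 0%MM.
  by rewrite mnm0E dvdn0.
rewrite exprS => /mcoeffM_neq0[a [b [-> a0 /IHm b0]]] i.
rewrite mnmDE dvdn_addl ?b0 //; move: a0.
apply: contraR => ndvd; rewrite raddf_sum big1 //= => j _.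
rewrite exprZn mcoeffZ mcoeffXn; case: eqP; rewrite ?mulr0 // => aE.
by move: ndvd; rewrite -aE mulmnE dvdn_mull.
Qed.

(* The class of [x^c] is killed by [l ^+ (p ^ s * m)], so the map is not
   injective; [x^b] is missed by it, because every monomial of its image has
   the residues modulo [p ^ s] of a monomial of the source. *)
Lemma not_mult_max_rank (d : nat -> nat) (l : {mpoly k[n]}) s m
    (c b : 'X_{1..n}) :
  l \is 1.-homog ->
  (forall i : 'I_n, c i < d i)%N -> (forall i : 'I_n, b i < d i)%N ->
  mdeg b = (mdeg c + p ^ s * m)%N ->
  (mdeg c < \sum_(i < n) b i %% p ^ s)%N ->
  (forall f : 'I_n -> nat, (forall i : 'I_n, c i + p ^ s * f i < d i)%N ->
     \sum_(i < n) f i <> m) ->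
  ~ mult_max_rank d l (mdeg c) (p ^ s * m).
Proof.
move=> l1 cd bd bc cb noroom [inj|surj].
  have /in_pow_idealP/(_ _ cd)/eqP : in_pow_ideal d ('X_[c] : {mpoly k[n]}).
    apply: inj; first by rewrite dhomogX.
    apply/in_pow_idealP => u ud; apply/eqP; apply: contraT.
    case/mcoeffM_neq0 => w [v [uE w0]]; rewrite mcoeffX.
    have [vE _|_ /eqP//] := eqVneq c v.
    have ws := linear_form_exp_supp l1 w0.
    have /eqP wm : mdeg w == (p ^ s * m)%N.
      apply: contraNT w0 => wm; have := dhomogMn (p ^ s * m) l1.
      by rewrite mul1n => /dhomog_nemf_coeff -> //.
    exfalso; apply: (noroom (fun i => w i %/ p ^ s)%N) => [i|].
      by rewrite mulnC divnK //; have := ud i; rewrite uE mnmDE vE addnC.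
    have q_gt0 : (0 < p ^ s)%N.
      by rewrite expn_gt0 prime_gt0 // (pcharf_prime charkp).
    apply/eqP; rewrite -(eqn_pmul2l q_gt0) -wm mdegE big_distrr /=.
    by apply/eqP/eq_bigr => i _; rewrite mulnC divnK.
  by rewrite mcoeffX eqxx oner_eq0.
have [|f fc] := surj ('X_[b]); first by rewrite dhomogX; apply/eqP.
move/in_pow_idealP/(_ _ bd)/eqP; rewrite mcoeffB mcoeffX eqxx subr_eq0 => /eqP.
move=> fb; have : (l ^+ (p ^ s * m) * f)@_b != 0 by rewrite -fb oner_eq0.
case/mcoeffM_neq0 => w [v [bE /(linear_form_exp_supp l1) ws v0]].
have /eqP vc : mdeg v == mdeg c.
  by apply: contraNT v0 => vc; rewrite (dhomog_nemf_coeff fc).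
move: cb; rewrite ltnNge => /negP; apply; rewrite -vc mdegE.
apply: leq_sum => i _; rewrite bE mnmDE -modnDml.
by rewrite (eqP (ws i)) add0n leq_mod.
Qed.

End Frobenius.

Lemma sum_leq_exact (I : finType) (w : I -> nat) q : (q <= \sum_i w i)%N ->
  exists v : I -> nat, (forall i, v i <= w i)%N /\ (\sum_i v i = q)%N.
Proof.
elim: q => [_|q IHq qw]; first by exists (fun _ => 0%N); rewrite big1.
have [v [vw vq]] := IHq (ltnW qw).
have /existsP[j jP] : [exists j, v j < w j]%N.
  apply: contraLR qw => /existsPn wv; rewrite -leqNgt -vq.
  by apply: leq_sum => i _; rewrite leqNgt wv.
exists (fun i => v i + (i == j))%N; split=> [i|].
  by have [->|_] := eqVneq i j; [rewrite addn1|rewrite addn0].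
rewrite big_split /= vq (bigD1 j) //= eqxx big1 ?addn0 ?addn1 //.
by move=> i /negbTE ->.
Qed.

(* The cost of an overflow: in the coordinates of [T] the residue of the
   exponent is taken above that of [d i - 1], which loses one multiple of
   [p ^ s]; elsewhere it is taken below. The number is the room left for the
   residue. *)
Definition residue_room (d : nat -> nat) (q : nat) (T : nat -> bool) i :=
  let r := ((d i - 1) %% q)%N in (if T i then q - 2 - r else r)%N.

Lemma not_SLP_residue_room (k : fieldType) (p n : nat) (d : nat -> nat) s
    (T : nat -> bool) (q := (p ^ s)%N) :
  p \in [pchar k] -> (forall i, i < n -> 0 < d i)%N ->
  (forall i, i < n -> T i -> q <= d i - 1 /\ (d i - 1) %% q + 2 <= q)%N ->
  (q <= \sum_(0 <= i < n) residue_room d q T i)%N ->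
  ~ has_SLP k n d.
Proof.
move=> charkp d_gt0 Tq room [l l1 SLP].
have q_gt0 : (0 < q)%N by rewrite expn_gt0 prime_gt0 // (pcharf_prime charkp).
rewrite big_mkord in room; have [v [vw vq]] := sum_leq_exact room.
(* In coordinate [i] the source exponent [c0 i] admits at most [F i] further factors [x_i ^ q], and
   [m] below is one more than the sum of the [F i]. The target [b] uses all these factors and makes
   up the missing degree [q] by the residues [v i]. *)
pose c0 i := (if T i then ((d i - 1) %% q).+1 else 0)%N.
pose F i := ((d i - 1) %/ q - T i)%N.
pose c := [multinom c0 i | i < n].
pose b := [multinom (c0 i + v i + q * F i)%N | i < n].
have vlt (i : 'I_n) : (c0 i + v i < q /\ c0 i + v i + q * F i < d i)%N.
  have := vw i; have := Tq _ (ltn_ord i); rewrite /residue_room /c0 /F.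
  have := ltn_pmod (d i - 1) q_gt0; have := divn_eq (d i - 1) q.
  have := d_gt0 _ (ltn_ord i).
  set Q := (_ %/ q)%N; set r := (_ %% q)%N.
  case: (T i) => /= di dE dr; last first.
    by move=> _ vi; rewrite subn0; split; nia.
  case=> // qd rq vi; have Q_gt0 : (0 < Q)%N by rewrite divn_gt0.
  by case: Q Q_gt0 dE => // Q _ dE; rewrite subn1 /=; split; nia.
have bmod i : (b i %% q = c0 i + v i)%N.
  by rewrite mnmE addnC mulnC modnMDl modn_small //; case: (vlt i).
pose m := (\sum_(i < n) F i).+1.
have qm_gt0 : (0 < q * m)%N by rewrite muln_gt0 q_gt0.
apply: (not_mult_max_rank charkp (c := c) (b := b) l1 _ _ _ _ _
  (SLP (mdeg c) _ qm_gt0)).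
- move=> i; rewrite mnmE; have [_] := vlt i; lia.
- by move=> i; rewrite mnmE; have [_] := vlt i.
- rewrite !mdegE /m; under eq_bigr do rewrite mnmE.
  rewrite !big_split /= vq -big_distrr /= -/q.
  under [in RHS]eq_bigr do rewrite mnmE.
  by rewrite mulnS addnA.
- rewrite mdegE -/q; under [X in (_ < X)%N]eq_bigr do rewrite bmod.
  under eq_bigr do rewrite mnmE.
  by rewrite big_split /= vq -[X in (X < _)%N]addn0 ltn_add2l.
- move=> f fd fm; suff: (\sum_(i < n) f i < m)%N by rewrite fm ltnn.
  rewrite ltnS; apply: leq_sum => i _; have := fd i.
  rewrite mnmE /c0 /F -/q; have := Tq _ (ltn_ord i).
  have := ltn_pmod (d i - 1) q_gt0; have := divn_eq (d i - 1) q.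
  have := d_gt0 _ (ltn_ord i).
  set Q := (_ %/ q)%N; set r := (_ %% q)%N.
  case: (T i) => /= di dE dr; last first.
    by move=> _ cd; rewrite subn0 -ltnS -(ltn_pmul2l q_gt0); nia.
  case=> // qd rq cd; rewrite subn1 -ltnS.
  have Q_gt0 : (0 < Q)%N by rewrite divn_gt0.
  by rewrite prednK // -(ltn_pmul2l q_gt0); nia.
Qed.

(** Each of the other terms contributes at least 1; this surplus is where [n >= 3] enters below. *)
Lemma leq_term_sum_nat (F : nat -> nat) m n j :
  (forall i, m <= i < n -> 0 < F i)%N -> (m <= j < n)%N ->
  (F j + (n - m).-1 <= \sum_(m <= i < n) F i)%N.
Proof.
move=> F_gt0 /andP[mj jn].
have gtS a b : (m <= a)%N -> (b <= n)%N -> (b - a <= \sum_(a <= i < b) F i)%N.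
  move=> ma bn; rewrite -[(b - a)%N]muln1 -sum_nat_const_nat.
  rewrite big_nat_cond [leqRHS]big_nat_cond; apply: leq_sum => i.
  by rewrite andbT => /andP[ai ib]; apply: F_gt0; lia.
rewrite (big_cat_nat mj (ltnW jn)) /= (big_ltn jn).
have := gtS _ _ (leqnn m) (ltnW jn); have := gtS _ _ (leqW mj) (leqnn n).
lia.
Qed.

(** * Necessity of the two conditions *)

Section Necessity.
Variables (k : fieldType) (p n : nat) (d : nat -> nat).
Hypothesis charkp : p \in [pchar k].
Hypothesis n_ge3 : (3 <= n)%N.
Hypothesis d_ge2 : forall i, (i < n)%N -> (2 <= d i)%N.
Hypothesis d_SLP : has_SLP k n d.

Let p_gt1 : (1 < p)%N. Proof. exact/prime_gt1/(pcharf_prime charkp). Qed.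

Let de_gt0 i : (1 <= i < n)%N -> (0 < d i - 1)%N.
Proof. by case/andP=> _ /d_ge2; lia. Qed.

Lemma SLP_residue_room s (T : nat -> bool) :
  (forall i, i < n -> T i ->
     p ^ s <= d i - 1 /\ (d i - 1) %% p ^ s + 2 <= p ^ s)%N ->
  (residue_room d (p ^ s) T 0 + \sum_(1 <= i < n) residue_room d (p ^ s) T i
     < p ^ s)%N.
Proof.
move=> TP; rewrite -big_ltn ?(ltn_trans _ n_ge3) // ltnNge; apply/negP => room.
by apply: (not_SLP_residue_room charkp _ TP room) d_SLP => i /d_ge2/ltnW.
Qed.

Lemma SLP_residue_sum s :
  ((d 0 - 1) %% p ^ s + \sum_(1 <= i < n) (d i - 1) %% p ^ s < p ^ s)%N.
Proof. exact: (@SLP_residue_room s (fun=> false)). Qed.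

Lemma SLP_sum_lt : (forall i, i < n -> d i <= p)%N ->
  (\sum_(0 <= i < n) (d i - 1) < p)%N.
Proof.
have n_gt0 : (0 < n)%N by lia.
move=> dp; have dE i : (i < n)%N -> ((d i - 1) %% p = d i - 1)%N.
  by move=> ni; rewrite modn_small //; have := dp i ni; have := d_ge2 ni; lia.
rewrite big_ltn //; have := SLP_residue_sum 1; rewrite expn1 dE //.
by under eq_big_nat => i /andP[_ /dE ->] do [].
Qed.

(* If all exponents but the first are below [p ^ s], then placing the overflow
   in the first coordinate or nowhere bounds their sum from two sides. *)
Lemma SLP_tail_bounds s (r := ((d 0 - 1) %% p ^ s)%N)
    (E := (\sum_(1 <= i < n) (d i - 1))%N) :
  (forall i, 1 <= i < n -> d i <= p ^ s)%N ->
  (r + E < p ^ s)%N /\ ((p ^ s < d 0)%N -> (E <= r.+1)%N).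
Proof.
move=> dp; have EE (T : nat -> bool) : (forall i, 1 <= i -> ~~ T i)%N ->
    (\sum_(1 <= i < n) residue_room d (p ^ s) T i)%N = E.
  move=> T1; apply: eq_big_nat => i /andP[i1 ni].
  have := dp i; have := d_ge2 ni; rewrite i1 ni /residue_room => di2 /(_ isT) di.
  by rewrite (negbTE (T1 _ i1)) modn_small //; lia.
have rE : (r + E < p ^ s)%N.
  by rewrite -(EE (fun=> false)) //; apply: SLP_residue_sum.
(* With [r + E < p ^ s] this yields [r + 2 <= p ^ s], as an overflow in the first coordinate
   requires. *)
split=> // pd0; have E_ge2 : (2 <= E)%N.
  have n1 : (1 <= 1 < n)%N by lia.
  have := leq_term_sum_nat de_gt0 n1; have := d_ge2 (ltnW n_ge3).
  by rewrite -/E; have := @d_ge2 1%N; lia.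
have : (residue_room d (p ^ s) (eq_op^~ 0) 0 + E < p ^ s)%N.
  rewrite -(EE (eq_op^~ 0%N)) => [|i]; last by rewrite -lt0n.
  by apply: SLP_residue_room => i _ /eqP ->; rewrite -/r; lia.
by rewrite /residue_room eqxx -/r; lia.
Qed.

(** Take the least power [2 ^ s.+1] bounding the tail exponents. Some [d j] exceeds [2 ^ s], so the
    tail sum [E] does too. Then [r >= 2 ^ s], from [d j <= d 0] if [d 0 <= 2 ^ s.+1] and from
    [E <= r.+1] otherwise, against [r + E < 2 ^ s.+1]. *)
Lemma SLP_char_neq2 : (forall i, i < n -> d i <= d 0)%N -> p != 2%N.
Proof.
move=> d_max; apply/eqP => p2.
have [|s sP s_min] :=
  @ex_minnP (fun s => all (fun i => d i <= 2 ^ s)%N (index_iota 1 n)).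
  exists (d 0); apply/allP => i; rewrite mem_index_iota => /andP[_ /d_max di].
  exact/(leq_trans di)/ltnW/ltn_expl.
have ds i : (1 <= i < n -> d i <= 2 ^ s)%N.
  by rewrite -mem_index_iota => /(allP sP).
case: s => [|s] in sP s_min ds *.
  by have := ds 1%N; have := @d_ge2 1%N; rewrite expn0; lia.
have [j jn dj] : exists2 j, (1 <= j < n)%N & (2 ^ s < d j)%N.
  have /allPn[j] : ~~ all (fun i => d i <= 2 ^ s)%N (index_iota 1 n).
    by apply/negP => /s_min; rewrite ltnn.
  by rewrite mem_index_iota -ltnNge; exists j.
have := @SLP_tail_bounds s.+1; rewrite p2 => /(_ ds)[].
have := leq_term_sum_nat de_gt0 jn.
have /andP[_ /d_max] := jn; rewrite expnS.
set E := bigop.body _ _ _; set r := (_ %% _)%N => dj0 Ej rE Er.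
have d0 : (2 * 2 ^ s < d 0)%N.
  rewrite ltnNge; apply/negP => d0; move: rE; rewrite /r modn_small; lia.
by have := Er d0; lia.
Qed.

(** For odd [p], the larger of [r] and [p - 2 - r] is at least [(p - 1) / 2]. If [d j > p] then also
    [d 0 > p], and these two coordinates have room [p - 1]; any third coordinate adds the missing
    1. *)
Lemma SLP_tail_le j : (forall i, i < n -> d i <= d 0)%N -> p != 2%N ->
  (1 <= j < n)%N -> (d j <= p)%N.
Proof.
move=> d_max p2 jn; rewrite leqNgt; apply/negP => pj.
have p_odd : p = (p./2).*2.+1.
  have [/eqP|podd] := even_prime (pcharf_prime charkp).
    by rewrite (negbTE p2).
  by rewrite -[LHS]odd_double_half podd.
(* Overflow exactly where this gives the larger room. *)
pose T i := ((p < d i) && (2 * ((d i - 1) %% p) + 2 <= p))%N.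
have : (residue_room d p T 0 + \sum_(1 <= i < n) residue_room d p T i < p)%N.
  rewrite -[X in residue_room d X]expn1 -[ltnRHS]expn1.
  by apply: SLP_residue_room => i' _ /andP[]; rewrite expn1; lia.
have w_gt0 i' : (1 <= i' < n)%N -> (0 < residue_room d p T i')%N.
  move=> /de_gt0 di; rewrite /residue_room /T.
  have [pd|dp] /= := ltnP p (d i'); last by rewrite modn_small; lia.
  by case: ifP => /=; lia.
have w_ge i' : (p < d i' -> (p./2).*2 <= residue_room d p T i' * 2)%N.
  move=> pd; rewrite /residue_room /T pd /=.
  by case: ifP => /=; lia.
have := leq_term_sum_nat w_gt0 jn; have := w_ge _ pj.
have /andP[_ /d_max dj] := jn; have := w_ge 0%N (leq_trans pj dj); lia.
Qed.

End Necessity.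

(** * Duality and reduction to injectivity *)

Section Duality.
Variables (k : fieldType) (n : nat) (d : nat -> nat).
Hypothesis d_gt0 : forall i, (i < n)%N -> (0 < d i)%N.
Implicit Types (f g L : {mpoly k[n]}) (c : 'X_{1..n}).

Let t := (\sum_(i < n) (d i - 1))%N.

Lemma in_pow_ideal_dhomog e f : f \is e.-homog -> (t < e)%N -> in_pow_ideal d f.
Proof.
move=> fe te; apply/in_pow_idealP => c cd; apply: (dhomog_nemf_coeff fe).
suff : (mdeg c < e)%N by rewrite ltn_neqAle => /andP[].
rewrite (leq_ltn_trans _ te) // /t mdegE; apply: leq_sum => i _.
by have := cd i; lia.
Qed.

Let dual c := [multinom (d i - 1 - c i)%N | i < n].

Let dual_lt c (i : 'I_n) : (dual c i < d i)%N.
Proof. by rewrite mnmE; have := d_gt0 (ltn_ord i); lia. Qed.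

Let dualK c : (forall i : 'I_n, c i < d i)%N -> dual (dual c) = c.
Proof. by move=> cd; apply/mnmP => i; rewrite !mnmE; have := cd i; lia. Qed.

Let mdeg_dual c : (forall i : 'I_n, c i < d i)%N ->
  (mdeg (dual c) + mdeg c = t)%N.
Proof.
move=> cd; rewrite !mdegE -big_split; apply: eq_bigr => i _ /=.
by rewrite mnmE; have := cd i; lia.
Qed.

(** The involution [dual] matches the monomial bases in degrees [j] and [j + m], so multiplication
    by [L] has a square matrix [M], and a trivial kernel makes it invertible. *)
Lemma surjective_of_injective j m L : (2 * j + m = t)%N -> L \is m.-homog ->
  (forall f, f \is j.-homog -> in_pow_ideal d (L * f) -> in_pow_ideal d f) ->
  forall g, g \is (j + m).-homog ->
    exists2 f, f \is j.-homog & in_pow_ideal d (g - L * f).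
Proof.
move=> jm Lm inj g gjm.
pose A := [set c : 'X_{1..n < t.+1} |
  (mdeg c == j) && [forall i : 'I_n, (c : 'X_{1..n}) i < d i]%N].
pose x (u : 'I_#|A|) : 'X_{1..n} := bmnm (enum_val u).
have xj u : mdeg (x u) = j.
  by have := enum_valP u; rewrite inE => /andP[/eqP].
have xd u (i : 'I_n) : (x u i < d i)%N.
  by have := enum_valP u; rewrite inE => /andP[_ /forallP].
have x_inj : injective x by move=> u v /val_inj/enum_val_inj.
have xP c : (forall i : 'I_n, c i < d i)%N -> mdeg c = (j + m)%N ->
    exists v, c = dual (x v).
  move=> cd cjm; have dc := mdeg_dual cd.
  have dct : (mdeg (dual c) < t.+1)%N by lia.
  have dcA : BMultinom dct \in A.
    rewrite inE /=; apply/andP; split; first by apply/eqP; lia.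
    by apply/forallP => i; apply: dual_lt.
  exists (enum_rank_in dcA (BMultinom dct)).
  by rewrite /x enum_rankK_in //= dualK.
pose fw (w : 'rV[k]_#|A|) : {mpoly k[n]} := \sum_u w 0 u *: 'X_[x u].
have fwj w : fw w \is j.-homog.
  by apply: rpred_sum => u _; apply: rpredZ; rewrite dhomogX; apply/eqP/xj.
pose M := \matrix_(u, v) (L * 'X_[x u])@_(dual (x v)).
have LfwE w v : (L * fw w)@_(dual (x v)) = (w *m M) 0 v.
  rewrite mxE mulr_sumr raddf_sum; apply: eq_bigr => u _ /=.
  by rewrite -scalerAr mcoeffZ mxE.
have homP h : h \is (j + m).-homog -> (forall v, h@_(dual (x v)) = 0) ->
    in_pow_ideal d h.
  move=> hjm h0; apply/in_pow_idealP => c cd.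
  have [/(xP _ cd)[v ->] //|] := eqVneq (mdeg c) (j + m)%N.
  exact: dhomog_nemf_coeff.
have Ljm h : h \is j.-homog -> L * h \is (j + m).-homog.
  by move=> hj; rewrite addnC; apply: dhomogM.
have M_unit : M \in unitmx.
  rewrite -row_free_unit; apply: inj_row_free => w wM.
  have /in_pow_idealP fw0 : in_pow_ideal d (fw w).
    apply: inj => //; apply: homP => [|v]; first exact: Ljm.
    by rewrite LfwE wM mxE.
  apply/rowP => u; rewrite mxE -(fw0 _ (xd u)) raddf_sum (bigD1 u) //=.
  rewrite mcoeffZ mcoeffX eqxx mulr1 big1 ?addr0 // => v vu.
  by rewrite mcoeffZ mcoeffX (inj_eq x_inj) (negbTE vu) mulr0.
pose w := (\row_v g@_(dual (x v))) *m invmx M.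
exists (fw w) => //; apply: homP => [|v].
  by apply: rpredB => //; apply: Ljm.
by rewrite mcoeffB LfwE mulmxKV // mxE subrr.
Qed.

(** If [2 * i + m <= t], the map is a first factor of an injective one. Otherwise, with
    [j = t - (i + m)], it is the last factor of the surjection from degree [j] to degree [i + m]. *)
Lemma mult_max_rank_of_injective (l : {mpoly k[n]}) : l \is 1.-homog ->
  (forall j f, (2 * j <= t)%N -> f \is j.-homog ->
     in_pow_ideal d (l ^+ (t - 2 * j) * f) -> in_pow_ideal d f) ->
  forall i m, mult_max_rank d l i m.
Proof.
move=> l1 inj i m; have lX e : l ^+ e \is e.-homog.
  by rewrite -[X in X.-homog]mul1n; apply: dhomogMn.
have [imt|imt] := leqP (2 * i + m) t.
  left=> f fi lfI; apply: inj (fi) _; first lia.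
  have -> : (t - 2 * i = (t - 2 * i - m) + m)%N by lia.
  by rewrite exprD -mulrA; apply: in_pow_idealMl.
right=> g gim; have [tim|imt'] := ltnP t (i + m).
  exists 0; first exact: dhomog0.
  by rewrite mulr0 subr0; apply: in_pow_ideal_dhomog gim tim.
pose j := (t - (i + m))%N.
have jm : (j + (t - 2 * j) = i + m)%N by rewrite /j; lia.
have [f fj gI] : exists2 f, f \is j.-homog &
    in_pow_ideal d (g - l ^+ (t - 2 * j) * f).
  apply: surjective_of_injective => [|||]; rewrite ?jm //; first by rewrite /j; lia.
  by move=> f; apply: inj; rewrite /j; lia.
exists (l ^+ (i - j) * f).
  have ij : (i - j + j = i)%N by rewrite /j; lia.
  by rewrite -[X in X.-homog]ij; apply: dhomogM.
rewrite mulrA -exprD.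
by have -> : (m + (i - j) = t - 2 * j)%N by rewrite /j; lia.
Qed.

End Duality.

(** * The sl2 argument *)

Section Lowering.
Variables (k : fieldType) (n : nat) (d : nat -> nat).
Implicit Types (f g : {mpoly k[n]}) (c : 'X_{1..n}).

Let t := (\sum_(i < n) (d i - 1))%N.
Let l : {mpoly k[n]} := \sum_(i < n) 'X_i.

Lemma mcoeffXU_mderiv (i : 'I_n) f c : ('X_i * f^`M(i))@_c = f@_c *+ c i.
Proof.
have [ci0|ci_gt0] := posnP (c i).
  rewrite ci0 mulr0n; apply/eqP; apply: contraT.
  case/mcoeffM_neq0 => a [b [cE]]; rewrite mcoeffX.
  have [aE|_ /eqP//] := eqVneq U_(i)%MM a.
  by move: ci0; rewrite cE -aE mnmDE mnm1E eqxx.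
pose m := (c - U_(i))%MM.
have -> : c = (U_(i) + m)%MM.
  by apply/mnmP => j; rewrite mnmDE mnmBE mnm1E; case: eqP => [<-|]; lia.
rewrite mulrC mcoeffMX mcoeff_deriv [(m + _)%MM]addmC.
by rewrite mnmDE mnm1E eqxx add1n.
Qed.

Lemma euler_dhomog e f : f \is e.-homog -> \sum_(i < n) 'X_i * f^`M(i) = f *+ e.
Proof.
move=> fe; apply/mpolyP => c; rewrite raddf_sum mcoeffMn /=.
under eq_bigr do rewrite mcoeffXU_mderiv.
rewrite sumrMnr -mdegE; have [->//|ce] := eqVneq (mdeg c) e.
by rewrite (dhomog_nemf_coeff fe ce) !mul0rn.
Qed.

(* Up to signs, [lowering], multiplication by [l] and the grading form an
   sl2-triple on the quotient; on monomials [lowering] sends [x_i ^ a] to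
   [a * (d i - a) * x_i ^ (a - 1)]. *)
Definition lowering f : {mpoly k[n]} :=
  \sum_(i < n) ((d i - 1)%:R *: f^`M(i) - 'X_i * f^`M(i)^`M(i)).

Lemma mcoeff_lowering f c : (lowering f)@_c =
  \sum_(i < n) ((d i - 1)%:R - (c i)%:R) * (f@_(c + U_(i)) *+ (c i).+1).
Proof.
rewrite raddf_sum; apply: eq_bigr => i _ /=.
rewrite mcoeffB mcoeffZ mcoeffXU_mderiv mcoeff_deriv.
by rewrite mulrBl; congr (_ - _); rewrite mulr_natl.
Qed.

Lemma lowering_dhomog e f : f \is e.+1.-homog -> lowering f \is e.-homog.
Proof.
move=> fe; apply/dhomogP => c; rewrite mcoeff_msupp mcoeff_lowering.
apply: contraNeq => ce; apply/eqP/big1 => i _.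
rewrite (dhomog_nemf_coeff fe) ?mul0rn ?mulr0 //.
by apply: contraNneq ce => /=; rewrite mdegD mdeg1 addn1 => -[->].
Qed.

Lemma lowering_dhomog0 f : f \is 0.-homog -> lowering f = 0.
Proof.
move=> f0; apply/mpolyP => c; rewrite mcoeff_lowering mcoeff0 big1 // => i _.
rewrite (dhomog_nemf_coeff f0) ?mul0rn ?mulr0 //=.
by rewrite mdegD mdeg1 addn1.
Qed.

(** A monomial can leave the ideal only by its exponent dropping from [d i] to [d i - 1], and there
    the factor [d i - 1 - c i] vanishes. *)
Lemma in_pow_ideal_lowering f : in_pow_ideal d f -> in_pow_ideal d (lowering f).
Proof.
move=> /in_pow_idealP fI; apply/in_pow_idealP => c cd.
rewrite mcoeff_lowering big1 // => i _.
have [ci|ci] := eqVneq (c i).+1 (d i).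
  by rewrite -ci subn1 subrr mul0r.
rewrite fI ?mul0rn ?mulr0 // => j; rewrite mnmDE mnm1E.
by have := cd j; case: eqP => [<-|]; lia.
Qed.

(** This is the sl2 commutator; Euler's identity evaluates the first-order terms. *)
Lemma loweringM e f : f \is e.-homog ->
  lowering (l * f) = l * lowering f + (t%:R - (2 * e)%:R) *: f.
Proof.
move=> fe; have lM g (i : 'I_n) : (l * g)^`M(i) = g + l * g^`M(i).
  have UU : (U_(i) - U_(i) = 0 :> 'X_{1..n})%MM.
    by apply/mnmP => j; rewrite mnmBE subnn mnm0E.
  rewrite mderivM raddf_sum (bigD1 i) //= mderivX mnm1E eqxx scale1r UU mpolyX0.
  rewrite big1 ?addr0 ?mul1r // => j ji.
  by rewrite mderivX mnm1E (negbTE ji) scale0r.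
rewrite /lowering; under eq_bigr => i _.
  rewrite !lM mderivD lM !mulrDr scalerDr.
  rewrite (_ : _ - _ = (d i - 1)%:R *: f - ('X_i * f^`M(i)) *+ 2
    + l * ((d i - 1)%:R *: f^`M(i) - 'X_i * f^`M(i)^`M(i))); last first.
    by rewrite mulrBr -[l * (_ *: _)]scalerAr; ring.
  over.
rewrite big_split /= -mulr_sumr addrC; congr (_ + _).
rewrite sumrB !sumrMnl (euler_dhomog fe).
by rewrite -scaler_suml -natr_sum scalerBl !scaler_nat -mulrnA mulnC.
Qed.

(** The scalar is the sum of the weights [t - 2 * (e + a)] for [a] from 0 to [m]. *)
Lemma lowering_expM e m f : f \is e.-homog ->
  lowering (l ^+ m.+1 * f) = l ^+ m.+1 * lowering f +
    (m.+1%:R * (t%:R - (2 * e)%:R - m%:R)) *: (l ^+ m * f).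
Proof.
have l1 : l \is 1.-homog by apply: rpred_sum => i _; rewrite dhomogX /= mdeg1.
move=> fe; elim: m => [|m IHm].
  by rewrite expr1 expr0 mul1r (loweringM fe) mul1r subr0.
have lfe : l ^+ m.+1 * f \is (m.+1 + e).-homog.
  by apply: dhomogM => //; rewrite -[X in X.-homog]mul1n; apply: dhomogMn.
rewrite exprS -mulrA (loweringM lfe) IHm mulrDr -addrA mulrA -exprS; congr (_ + _).
rewrite -scalerAr mulrA -exprS -scalerDl; congr (_ *: _).
by ring.
Qed.

Hypothesis t_small : forall m, (0 < m <= t)%N -> m%:R != 0 :> k.

(** Lowering [l ^+ (t - 2 * e).+1 * f], where the scalar vanishes, puts [lowering f] in the ideal by
    induction on [e]. Lowering then strips one [l] at a time from [l ^+ m.+1 * f], with scalar a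
    product of two integers between 1 and [t]. *)
Lemma injective_small e : forall f, (2 * e <= t)%N -> f \is e.-homog ->
  in_pow_ideal d (l ^+ (t - 2 * e) * f) -> in_pow_ideal d f.
Proof.
elim/ltn_ind: e => e IHe f.
have step g e' m : g \is e'.-homog -> in_pow_ideal d (l ^+ m.+1 * g) ->
    in_pow_ideal d (l ^+ m.+1 * lowering g +
      (m.+1%:R * (t%:R - (2 * e')%:R - m%:R)) *: (l ^+ m * g)).
  by move=> ge' lgI; rewrite -lowering_expM //; apply: in_pow_ideal_lowering.
move=> et fe lfI; have Yf : in_pow_ideal d (lowering f).
  case: e et fe lfI IHe => [|e] et fe lfI IHe.
    by rewrite lowering_dhomog0 //; apply: in_pow_ideal0.
  apply: (IHe e) (lowering_dhomog fe) _ => //; first lia.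
  have -> : (t - 2 * e = (t - 2 * e.+1).+2)%N by lia.
  rewrite exprS -mulrA; apply: in_pow_idealMl.
  have := step _ _ (t - 2 * e.+1)%N fe.
  rewrite exprS -[l * _ * f]mulrA => /(_ (in_pow_idealMl _ lfI)).
  by rewrite natrB // subrr mulr0 scale0r addr0.
move: lfI; have : (t - 2 * e <= t - 2 * e)%N by [].
elim: {1 3}(t - 2 * e)%N => [|m IHm] mt lfI; first by rewrite expr0 mul1r in lfI.
apply: IHm; first exact: ltnW.
have := in_pow_idealB (step _ _ _ fe lfI) (in_pow_idealMl (l ^+ m.+1) Yf).
rewrite addrC addKr -!natrB; try lia.
set s := (_ * _) => /(in_pow_idealMl s^-1%:MP).
rewrite mul_mpolyC scalerA mulVf ?scale1r // mulf_neq0 // t_small //; lia.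
Qed.

End Lowering.

(** * Sufficiency of the two conditions *)

Lemma in_pow_ideal_colon (k : comNzRingType) (n : nat) (d d' : nat -> nat)
    (i : 'I_n) e (g : {mpoly k[n]}) :
  (forall j : 'I_n, d' j + e * (i == j) <= d j)%N ->
  in_pow_ideal d ('X_i ^+ e * g) -> in_pow_ideal d' g.
Proof.
move=> dd' /in_pow_idealP gI; apply/in_pow_idealP => c cd'.
rewrite -(mcoeffMX g (U_(i) *+ e) c) mulrC -mpolyXn gI // => j.
by rewrite mnmDE mulmnE mnm1E; have := dd' j; have := cd' j; lia.
Qed.

Section Sufficiency.
Variables (k : fieldType) (p n : nat) (d : nat -> nat).
Hypothesis charkp : p \in [pchar k].

Let l : {mpoly k[n]} := \sum_(i < n) 'X_i.
Let l1 : l \is 1.-homog.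
Proof. by apply: rpred_sum => i _; rewrite dhomogX /= mdeg1. Qed.

Lemma pchar_natr_neq0 t : (t < p)%N ->
  forall m, (0 < m <= t)%N -> m%:R != 0 :> k.
Proof.
move=> tp m /andP[m_gt0 mt]; rewrite -(dvdn_pcharf charkp) gtnNdvd //.
exact: leq_ltn_trans tp.
Qed.

Lemma SLP_small : (forall i, i < n -> 0 < d i)%N ->
  (\sum_(0 <= i < n) (d i - 1) < p)%N -> has_SLP k n d.
Proof.
move=> d_gt0; rewrite big_mkord => tp; exists l => // i m _.
apply: mult_max_rank_of_injective => // j f jt fj.
exact: injective_small (pchar_natr_neq0 tp) _ _ jt fj.
Qed.

(** The difference of the two powers is a multiple of [l ^+ p - 'X_i0 ^+ p], the sum of the other
    ['X_j ^+ p]. *)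
Lemma in_pow_ideal_frobenius (i0 : 'I_n) N (g : {mpoly k[n]}) :
  (forall j : 'I_n, j != i0 -> d j <= p)%N ->
  in_pow_ideal d (l ^+ (p * N) * g) -> in_pow_ideal d ('X_i0 ^+ (p * N) * g).
Proof.
move=> dp lgI; suff dI : in_pow_ideal d (l ^+ (p * N) - 'X_i0 ^+ (p * N)).
  have := in_pow_idealB lgI (in_pow_idealMr g dI).
  by rewrite -mulrBl opprB addrC subrK.
rewrite !exprM subrXX; apply: in_pow_idealMr.
have := @mpoly_exp_sum_pchar k p n charkp 1 _ (index_enum 'I_n) (fun i => 'X_i).
rewrite expn1 -/l => ->; rewrite (bigD1 i0) //= addrAC subrr add0r.
by apply: in_pow_ideal_sum => j ji0; apply/in_pow_idealXn/dp.
Qed.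

End Sufficiency.

Lemma SLP_large (k : fieldType) (p n : nat) (d : nat -> nat) (N r : nat) :
  p \in [pchar k] -> (0 < n)%N -> (forall i, i < n -> 0 < d i)%N ->
  d 0%N = (N * p + r)%N -> (0 < r)%N ->
  (forall i, 1 <= i < n -> d i <= p)%N -> 
  (\sum_(1 <= i < n) (d i - 1) <= minn r (p - r))%N ->
  has_SLP k n d.
Proof.
case: n => // n charkp _ d_gt0 d0 r_gt0 dp; set E := bigop.body _ _ _.
rewrite leq_min => /andP[Er Ep].
pose upd b i := if i == 0%N then b else d i.
pose l : {mpoly k[n.+1]} := \sum_(i < n.+1) 'X_i.
have l1 : l \is 1.-homog by apply: rpred_sum => i _; rewrite dhomogX /= mdeg1.
have sum_upd b : (\sum_(i < n.+1) (upd b i - 1) = b - 1 + E)%N.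
  by rewrite big_ord_recl /= /E big_add1 big_mkord.
have tE : (\sum_(i < n.+1) (d i - 1) = d 0 - 1 + E)%N.
  by rewrite -sum_upd; apply: eq_bigr => -[[]].
have updp b (j : 'I_n.+1) : j != ord0 -> (upd b j <= p)%N.
  by case: j => [[|j] jn] //= _; apply: dp.
exists l => // i m _; apply: mult_max_rank_of_injective => // {i m} j f.
rewrite tE => jt fj /in_pow_idealP lfI; have [jE|Ej] := ltnP j E.
  (* After [d 0] is replaced by [r], the sum is [r - 1 + E], which is below [p] since [E <= p - r]
     and at least [2 * j] since [j < E <= r]. *)
  have f_upd : in_pow_ideal (upd r) f.
    apply: (@injective_small k n.+1 (upd r) _ j f) => //.
    - by rewrite sum_upd; apply: (pchar_natr_neq0 charkp); lia.
    - by rewrite sum_upd; lia.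
    apply: (@in_pow_ideal_colon _ _ d _ ord0 (p * N)).
      by case=> [[|i] i_lt] /=; rewrite /upd /=; lia.
    apply: (in_pow_ideal_frobenius charkp) => [i /(updp (d 0%N))|].
      by case: i => [[]].
    rewrite mulrA -exprD sum_upd; apply/in_pow_idealP.
    by have -> : (p * N + (r - 1 + E - 2 * j) = d 0 - 1 + E - 2 * j)%N by lia.
  apply/in_pow_idealP => c cd; have [cr|rc] := ltnP (c ord0) r.
    move/in_pow_idealP: f_upd; apply => i.
    have := cd i; case: i => [[|i] i_lt] //=.
    by rewrite /upd /= (_ : Ordinal _ = ord0) //; apply: val_inj.
  (* Exponents at least [r] in the first variable do not occur in degree [j < E <= r]. *)
  apply: (dhomog_nemf_coeff fj); rewrite neq_ltn; apply/orP; right.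
  by rewrite /= mdegE big_ord_recl; apply: leq_trans jE _; lia.
set m := (_ - _)%N in lfI.
have pm : (m <= p * m)%N.
  by rewrite leq_pmull // prime_gt0 // (pcharf_prime charkp).
(* Since [j >= E], the degree [m + j] of [l ^+ m * f] is below [d 0], so the first bound can be
   raised by [p * m]; cancelling ['X_ord0 ^+ (p * m)] restores it. *)
apply: (@in_pow_ideal_colon _ _ (upd (d 0 + p * m)%N) d ord0 (p * m)).
  by case=> [[|i] i_lt]; rewrite /upd -val_eqE /= ?muln1 ?muln0 ?addn0.
apply: (in_pow_ideal_frobenius charkp); first exact: updp.
rewrite -(subnK pm) exprD -mulrA; apply: in_pow_idealMl.
apply/in_pow_idealP => c cd; have [c0|c0] := ltnP (c ord0) (d 0%N).
  apply: lfI => i; have := cd i.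
  case: i => [[|i] i_lt] //=.
  by rewrite /upd /= (_ : Ordinal _ = ord0) //; apply: val_inj.
have lf : l ^+ m * f \is (m + j).-homog.
  by apply: dhomogM => //; rewrite -[X in X.-homog]mul1n; apply: dhomogMn.
apply: (dhomog_nemf_coeff lf); rewrite neq_ltn; apply/orP; right.
by rewrite /= mdegE big_ord_recl; apply: leq_trans _ (leq_addr _ _); rewrite /m; lia.
Qed.

(* Variables x_1..x_n are indexed 0..n-1; d_1 of the paper is d 0. *)
Theorem theorem3p8 (k : fieldType) (p : nat) (n : nat) (d : nat -> nat)
  (N1 r1 : nat) :
  prime p -> p \in [pchar k]%R ->
  (3 <= n)%N ->
  (forall i, (i < n)%N -> (2 <= d i)%N) ->
  (forall i, (i < n)%N -> (d i <= d 0%N)%N) ->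
  d 0%N = (N1 * p + r1)%N -> (0 < r1)%N -> (r1 <= p)%N ->
  has_SLP k n d <->
  ((\sum_(0 <= i < n) (d i - 1) < p)%N
   \/
   [/\ (p < d 0%N)%N,
       (forall i, (1 <= i < n)%N -> (d i <= p)%N) &
       (\sum_(1 <= i < n) (d i - 1) <= minn r1 (p - r1))%N]).
Proof.
move=> pr_p charkp n_ge3 d_ge2 d_max d0 r1_gt0 r1_le.
have d_gt0 i : (i < n)%N -> (0 < d i)%N by move/d_ge2/ltnW.
have n_gt0 : (0 < n)%N by lia.
split=> [SLP|]; last first.
  case=> [small|[_ dp room]]; first exact: (SLP_small charkp d_gt0).
  exact: (SLP_large charkp n_gt0 d_gt0 d0).
have [d0p|pd0] := leqP (d 0%N) p; [left|right].
  by apply: (SLP_sum_lt charkp n_ge3 d_ge2 SLP) => i /d_max di; apply: leq_trans d0p.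
have dp := SLP_tail_le charkp n_ge3 d_ge2 SLP d_max
  (SLP_char_neq2 charkp n_ge3 d_ge2 SLP d_max).
(* For [s = 1] the residue is [r1 - 1], so the two bounds become [E <= p - r1] and [E <= r1]. *)
split=> //; have := @SLP_tail_bounds _ _ _ _ charkp n_ge3 d_ge2 SLP 1.
rewrite expn1 (_ : (d 0 - 1) %% p = r1 - 1)%N; last first.
  by rewrite d0 -addnBA // modnMDl modn_small //; lia.
by case=> [j /dp//|] rE /(_ pd0); lia.
Qed.
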